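(* Let $\alpha\in[0,\tfrac12)$, let $d,D,n\ge1$ be integers, and let $(\rho_\nu)_{\nu\in\{-1,1\}^D}$ be a family of states in $\mathcal S(\mathbb C^d)$. Let $M=M_1\otimes\dots\otimes M_n$ be any locally-$\alpha$-gentle measurement on $n$ copies of $\mathbb C^d$, applied to $\rho_\nu^{\otimes n}$, let $\mathbb P_\nu^{R^M,n}$ be the outcome distribution, and let $\mathbb P^{R^M,n}_{\pm j}=\frac1{2^{D-1}}\sum_{\nu:\nu_j=\pm1}\mathbb P_\nu^{R^M,n}$ for $j=1,\dots,D$. Then $$\sum_{j=1}^D D_{KL}^{sym}\big(\mathbb P_{+j}^{R^M,n}\,\big\|\,\mathbb P_{-j}^{R^M,n}\big)\le\frac{64\,n\,\alpha^2}{(1-2\alpha)^4}\ \sup_{A}\ \sum_{j=1}^D\frac1{2^{D-1}}\sum_{\nu\in\{-1,1\}^{D-1}}\operatorname{Tr}\big[A(\rho_{\nu_{j+}}-\rho_{\nu_{j-}})\big]^2,$$ where the supremum is over positive semidefinite $A\in\mathbb C^{d\times d}$ with $\|A\|_{op}\le1$, and for $\nu\in\{-1,1\}^{D-1}$, $\nu_{j+}$ and $\nu_{j-}$ denote the vectors in $\{-1,1\}^D$ obtained from $\nu$ by inserting $+1$, respectively $-1$, as $j$-th component.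
   Context: $\mathcal S(\mathbb C^d)$ is the set of density matrices (positive semidefinite, trace 1) on $\mathbb C^d$. A measurement on $\mathbb C^d$ is a countable family $M=(M_\omega)_{\omega\in\Omega}$ of matrices in $\mathbb C^{d\times d}$ with $\sum_\omega M_\omega^*M_\omega=\mathbb 1$; put $E_\omega=M_\omega^*M_\omega$. Measuring $\rho$ yields a random outcome $R^M$ with $\mathbb P_\rho(R^M=\omega)=\operatorname{Tr}[\rho E_\omega]$ and, if this is positive, the post-measurement state $\rho_{M\to\omega}=M_\omega\rho M_\omega^*/\operatorname{Tr}[\rho E_\omega]$. With $\|A\|_{Tr}=\frac12\operatorname{Tr}|A|$, $M$ is $\alpha$-gentle on $\mathcal S(\mathbb C^d)$ if $\|\rho-\rho_{M\to\omega}\|_{Tr}\le\alpha$ for all $\rho\in\mathcal S(\mathbb C^d)$ and all outcomes $\omega$ (of positive probability). A locally-$\alpha$-gentle measurement on $n$ copies is a product measurement $M_1\otimes\dots\otimes M_n$ in which each $M_i=(M_{\omega_i,i})_{\omega_i}$ is $\alpha$-gentle on $\mathcal S(\mathbb C^d)$; applied to $\rho_\nu^{\otimes n}$ it has outcome distribution $\mathbb P_\nu^{R^M,n}(\{(\omega_1,\dots,\omega_n)\})=\prod_{i=1}^n\operatorname{Tr}[\rho_\nu M_{\omega_i,i}^*M_{\omega_i,i}]$. $D_{KL}^{sym}(P\|Q)=D_{KL}(P\|Q)+D_{KL}(Q\|P)$ is the symmetrized Kullback–Leibler divergence; $\|\cdot\|_{op}$ is the operator norm. *)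

(* Defs.v *)
(* MathComp / MathComp-Analysis. *)
From mathcomp Require Export all_boot all_order all_algebra.
From mathcomp Require Export complex.
From mathcomp Require Export all_classical all_reals all_analysis.
From mathcomp Require Export summability.

Set Implicit Arguments.
Unset Strict Implicit.
Unset Printing Implicit Defensive.

Import Order.TTheory GRing.Theory Num.Theory.
Import numFieldNormedType.Exports.

Local Open Scope classical_set_scope.
Local Open Scope ring_scope.
Local Open Scope complex_scope.
Local Open Scope sesquilinear_scope.

Section Matrices.
Context {R : realType} {d : nat}.
Implicit Types (A rho : 'M[R[i]]_d) (v : 'cV[R[i]]_d).

(* In the partial order of [R[i]], [0 <= z] means that [z] is real and
   nonnegative. *)
Definition psdmx A : Prop :=
  A^t* = A /\ forall v, 0 <= (v^t* *m A *m v) 0 0.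

Definition density rho : Prop := psdmx rho /\ \tr rho = 1.

(* |A| = (A^* A)^(1/2), through the unitary diagonalization of the normal
   matrix A^* A, whose eigenvalues are nonnegative. *)
Definition absmx A : 'M[R[i]]_d :=
  let B := A^t* *m A in
  invmx (spectralmx B) *m diag_mx (map_mx sqrtC (spectral_diag B))
    *m spectralmx B.

Definition trace_norm A : R := complex.Re (\tr (absmx A)) / 2.

Definition norm2 v : R :=
  Num.sqrt (\sum_(k < d) ComplexField.Normc.normc (v k 0) ^+ 2).

Definition opnorm A : R := sup [set norm2 (A *m v) | v in [set v | norm2 v <= 1]].

End Matrices.

Section Measurements.
Context {R : realType} {d : nat}.

(* Taking Re loses nothing below: the traces involved are traces of products
   of two Hermitian matrices, hence real. *)
Definition rtrace (A : 'M[R[i]]_d) : R := complex.Re (\tr A).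

Definition effect (Omega : Type) (M : Omega -> 'M[R[i]]_d) (w : Omega) :
  'M[R[i]]_d := (M w)^t* *m M w.

(* [totally] is the filter of finite subsets of [Omega] directed by inclusion,
   so that this is (unconditional) convergence of the series of matrices. *)
Definition measurement (Omega : countType) (M : Omega -> 'M[R[i]]_d) : Prop :=
  partial_sum (effect M) @ totally --> (1%:M : 'M[R[i] : numFieldType]_d).

Definition post_state (Omega : Type) (M : Omega -> 'M[R[i]]_d)
    (rho : 'M[R[i]]_d) (w : Omega) : 'M[R[i]]_d :=
  (\tr (rho *m effect M w))^-1 *: (M w *m rho *m (M w)^t*).

Definition gentle (Omega : Type) (alpha : R) (M : Omega -> 'M[R[i]]_d) : Prop :=
  forall (rho : 'M[R[i]]_d) (w : Omega), density rho ->
    0 < rtrace (rho *m effect M w) ->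
    trace_norm (rho - post_state M rho w) <= alpha.

(* The product measurement M_1 (x) ... (x) M_n is represented by the family of
   its factors; the i-th factor has its own countable outcome set [Omega i]. *)
Definition locally_gentle (n : nat) (Omega : 'I_n -> countType) (alpha : R)
    (M : forall i, Omega i -> 'M[R[i]]_d) : Prop :=
  forall i, measurement (M i) /\ gentle alpha (M i).

(* Probability mass function of the outcome of the product measurement applied
   to the n-fold tensor power of [rho]. *)
Definition outcome_dist (n : nat) (Omega : 'I_n -> countType)
    (M : forall i, Omega i -> 'M[R[i]]_d) (rho : 'M[R[i]]_d)
    (w : {dffun forall i : 'I_n, Omega i}) : R :=
  \prod_(i < n) rtrace (rho *m effect (M i) (w i)).

End Measurements.

Section Divergence.
Context {R : realType} {T : countType}.
Implicit Types p q : T -> R.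

(* For probability mass functions the sum of the negative parts of
   p ln (p / q) is finite, so the difference below is never oo - oo. Terms with
   p x = 0 vanish. *)
Definition kl_div p q : \bar R :=
  let f x := (p x * ln (p x / q x))%:E in
  if `[< forall x, q x = 0 -> p x = 0 >] then
    (\esum_(x in [set: T]) f^\+%E x - \esum_(x in [set: T]) f^\-%E x)%E
  else +oo%E.

Definition kl_sym p q : \bar R := (kl_div p q + kl_div q p)%E.

End Divergence.

(* Sign vectors of {-1,1}^D, with [true] for +1 and [false] for -1. *)
Definition signs (D : nat) : finType := {ffun 'I_D -> bool}.

Definition insert_sign (D : nat) (j : 'I_D) (b : bool) (nu : signs D.-1) :
  signs D := [ffun k => if unlift j k is Some k' then nu k' else b].

(* The mixture over all nu whose j-th component is b. *)
Definition mixture (R : realType) (D : nat) (T : Type) (P : signs D -> T -> R)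
    (j : 'I_D) (b : bool) (w : T) : R :=
  (2 ^+ D.-1)^-1 * \sum_(nu : signs D | nu j == b) P nu w.

(* Main.v *)
Require Import Defs.
From mathcomp Require Import ring lra finmap.

Set Implicit Arguments.
Unset Strict Implicit.
Unset Printing Implicit Defensive.

Import Order.TTheory GRing.Theory Num.Theory.
Import numFieldNormedType.Exports.

Local Open Scope classical_set_scope.
Local Open Scope ring_scope.

(** The effects of a gentle measurement are nearly multiples of the identity,
    and this is the only way in which gentleness enters.

    Let E be an effect, let a and b be orthonormal eigenvectors of E, and let
    s^2 and t^2 be their eigenvalues.  The pure states proportional to
    a + th b with |th| = 1 are sent to the span of M a and M b, which are
    orthogonal vectors of norms s and t.  On average over th the squared
    overlap of input and output is at most (s + t)^2 / (2 (s^2 + t^2)), whatever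
    the directions of M a and M b are ([rotating_overlap]); gentleness bounds
    each of these overlaps from below ([gentle_overlap]).  Hence
    |s - t| <= 2 alpha (s + t), so any two eigenvalues of E have a ratio of at
    most kappa = ((1 + 2 alpha) / (1 - 2 alpha))^2
    ([gentle_eigenvalue_ratio]).  With l the least eigenvalue, E can therefore
    be written l + (kappa - 1) l A with 0 <= A <= 1
    ([balanced_decomposition]), and
    kappa - 1 = 8 alpha / (1 - 2 alpha)^2.

    For two states the outcome probabilities p, q of such an effect are at
    least l and differ by (kappa - 1) l Tr[A (rho - rho')].  Since
    (p - q) ln (p / q) <= (p - q)^2 / l, this outcome contributes at most
    (kappa - 1)^2 l Tr[A (rho - rho')]^2 to the symmetrized divergence
    ([jeffreys_outcome_le]).  The numbers l sum to at most 1 over the outcomes,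
    because the effects sum to the identity, so one factor of the product
    measurement contributes at most (kappa - 1)^2 times the supremum.  The
    n factors add up by the chain rule ([jeffreys_product]), and mixtures only
    decrease the divergence, by the log-sum inequality ([jeffreys_sum]).

    The chain rule is an identity between signed sums, so it is used only for
    finitely many outcomes.  A sum of nonnegative terms over a countable set is
    the supremum of its finite parts, and a finite part is dominated by the full
    sum for the measurement in which all outcomes of large code are merged into
    one ([finite_coarse_graining]).  The merged effect is a limit of sums of
    effects and has the same eigenvalue ratio bound, since that bound defines a
    closed convex cone ([balanced_sum], [balanced_closed]). *)

Lemma eq_ler (K : numDomainType) (x y : K) : x = y -> x <= y.
Proof. by move=> ->. Qed.

(** * Inner products and spectral forms *)

Section InnerProduct.
Local Open Scope sesquilinear_scope.
Variables (C : numClosedFieldType) (d : nat).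
Implicit Types (x y z : 'cV[C]_d) (A E : 'M[C]_d).

(** Conjugate-linear in the first argument. *)
Definition ip x y : C := (x^t* *m y) 0 0.

Lemma ipE x y : ip x y = \sum_k (x k 0)^* * y k 0.
Proof. by rewrite /ip mxE; apply: eq_bigr => k _; rewrite !mxE. Qed.

Lemma ipDl x y z : ip (x + y) z = ip x z + ip y z.
Proof.
by rewrite !ipE -big_split; apply: eq_bigr => k _; rewrite !mxE rmorphD mulrDl.
Qed.

Lemma ipDr x y z : ip x (y + z) = ip x y + ip x z.
Proof. by rewrite /ip mulmxDr mxE. Qed.

Lemma ipBr x y z : ip x (y - z) = ip x y - ip x z.
Proof. by rewrite /ip mulmxBr !mxE. Qed.

Lemma ipZl c x y : ip (c *: x) y = c^* * ip x y.
Proof. by rewrite !ipE mulr_sumr; apply: eq_bigr => k _; rewrite !mxE rmorphM mulrA. Qed.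

Lemma ipZr c x y : ip x (c *: y) = c * ip x y.
Proof. by rewrite /ip -scalemxAr mxE. Qed.

Lemma ipC x y : ip y x = (ip x y)^*.
Proof.
rewrite !ipE rmorph_sum; apply: eq_bigr => k _.
by rewrite rmorphM /= conjCK mulrC.
Qed.

Lemma ipxx x : ip x x = \sum_k `|x k 0| ^+ 2.
Proof. by rewrite ipE; apply: eq_bigr => k _; rewrite normCK mulrC. Qed.

Lemma ipxx_ge0 x : 0 <= ip x x.
Proof. by rewrite ipxx sumr_ge0// => k _; rewrite exprn_ge0. Qed.

Lemma trmxC_mul m n p (A : 'M[C]_(m, n)) (B : 'M[C]_(n, p)) :
  (A *m B)^t* = B^t* *m A^t*.
Proof. by rewrite trmx_mul map_mxM. Qed.

Lemma ip_adj A x y : ip x (A *m y) = ip (A^t* *m x) y.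
Proof. by rewrite /ip trmxC_mul trmxCK mulmxA. Qed.

Lemma trace_rank1 x y : \tr (x *m y^t*) = ip y x.
Proof. by rewrite mxtrace_mulC /mxtrace big_ord1. Qed.

Lemma trace_rank1_mul A x y : \tr (A *m (x *m y^t*)) = ip y (A *m x).
Proof. by rewrite mulmxA trace_rank1. Qed.

(** The squared norm of the component of [x] orthogonal to [a] and [b] is the
    difference of the two sides. *)
Lemma bessel x a b : ip a a = 1 -> ip b b = 1 -> ip a b = 0 ->
  `|ip a x| ^+ 2 + `|ip b x| ^+ 2 <= ip x x.
Proof.
move=> a1 b1 ab.
have ba : ip b a = 0 by rewrite ipC ab conjC0.
have := ipxx_ge0 (x + (- (ip a x)) *: a + (- (ip b x)) *: b).
set z := ip _ _ => z0.
suff -> : ip x x = `|ip a x| ^+ 2 + `|ip b x| ^+ 2 + z by rewrite lerDl.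
rewrite /z !(ipDl, ipDr, ipZl, ipZr) a1 b1 ab ba !rmorphN /= -!ipC !normCK -!ipC; ring.
Qed.

Lemma ip_unitary (P : 'M[C]_d) x : P \is unitarymx -> ip (P *m x) (P *m x) = ip x x.
Proof.
move=> Pu; rewrite /ip trmxC_mul -mulmxA (mulmxA (P^t*)).
have := Pu; rewrite -trmxC_unitary => /unitarymxP; rewrite trmxCK => ->.
by rewrite mul1mx.
Qed.

Definition specmx (P : 'M[C]_d) (D : 'rV[C]_d) : 'M[C]_d := P^t* *m diag_mx D *m P.

Lemma ip_specmx P D x :
  ip x (specmx P D *m x) = \sum_k D 0 k * `|(P *m x) k 0| ^+ 2.
Proof.
rewrite /specmx -!mulmxA ip_adj trmxCK ipE; apply: eq_bigr => k _.
by rewrite mul_diag_mx [X in _ * X = _]mxE normCK; ring.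
Qed.

Lemma specmx_adj (P : 'M[C]_d) (D : 'rV[C]_d) :
  (forall k, D 0 k \is Num.real) -> (specmx P D)^t* = specmx P D.
Proof.
move=> Dr; rewrite /specmx !trmxC_mul trmxCK mulmxA; congr (_ *m _ *m _).
apply/matrixP => i j; rewrite !mxE eq_sym.
by case: eqVneq => [->|_]; rewrite ?mulr1n ?mulr0n ?conjC0//; exact/CrealP.
Qed.

Lemma hermitian_specmx E : E^t* = E ->
  exists P D, P \is unitarymx /\ E = specmx P D.
Proof.
move=> Eh; exists (spectralmx E), (spectral_diag E); split.
  exact: spectral_unitarymx.
have : E \is normalmx by apply/normalmxP; rewrite Eh.
by move=> /orthomx_spectralP {1}->; rewrite invmx_unitary// spectral_unitarymx.
Qed.

Definition specvec (P : 'M[C]_d) k : 'cV[C]_d := P^t* *m delta_mx k 0.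

Lemma mul_specvec P k : P \is unitarymx -> P *m specvec P k = delta_mx k 0.
Proof. by move=> /unitarymxP Pu; rewrite /specvec mulmxA Pu mul1mx. Qed.

Lemma ip_specvec P j k : P \is unitarymx -> ip (specvec P j) (specvec P k) = (j == k)%:R.
Proof.
move=> Pu; rewrite {1}/specvec -[P^t*](trmxCK (P^t*)) -ip_adj trmxCK mul_specvec//.
rewrite ipE (bigD1 j)//= big1 ?addr0; last first.
  by move=> i ij; rewrite !mxE (negPf ij) /= conjC0 mul0r.
by rewrite !mxE !eqxx /= conjC1 mul1r andbT.
Qed.

Lemma specmx_specvec P D k : P \is unitarymx ->
  specmx P D *m specvec P k = D 0 k *: specvec P k.
Proof.
move=> Pu; rewrite /specmx -mulmxA mul_specvec// -mulmxA scalemxAr; congr (_ *m _).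
apply/matrixP => i j; rewrite mul_diag_mx !mxE ord1.
by case: eqVneq => [->//|]; rewrite /= !mulr0.
Qed.

Lemma parallelogram (z t : C) :
  `|z + t| ^+ 2 + `|z - t| ^+ 2 = 2 * `|z| ^+ 2 + 2 * `|t| ^+ 2.
Proof. by rewrite !normCK rmorphD rmorphB; ring. Qed.

(** The average of the right-hand side of the hypothesis over the fourth roots
    of unity is the bound: all the cross terms cancel.  The roots 1 and -1 alone
    would leave the cross term of [ga] and [de], which carries [th ^+ 2]. *)
Lemma phase_average (c al be ga de : C) :
  (forall th, `|th| = 1 -> c <= `|al + be + th * ga + th^* * de| ^+ 2) ->
  c <= `|al + be| ^+ 2 + `|ga| ^+ 2 + `|de| ^+ 2.
Proof.
move=> H; rewrite -(ler_pM2l (ltr0n C 4)).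
have h1 : `|1 : C| = 1 by rewrite normr1.
have h2 : `|-1 : C| = 1 by rewrite normrN1.
have h3 : `|'i : C| = 1 by rewrite normCi.
have h4 : `|- 'i : C| = 1 by rewrite normrN normCi.
have := lerD (lerD (H _ h1) (H _ h2)) (lerD (H _ h3) (H _ h4)).
rewrite conjC1 !rmorphN /= conjC1 !conjCi !opprK.
have -> : al + be + 1 * ga + 1 * de = (al + be) + (ga + de) by ring.
have -> : al + be + -1 * ga + -1 * de = (al + be) - (ga + de) by ring.
have -> : al + be + 'i * ga + - 'i * de = (al + be) + 'i * (ga - de) by ring.
have -> : al + be + - 'i * ga + 'i * de = (al + be) - 'i * (ga - de) by ring.
rewrite !parallelogram normrM normCi mul1r => HH.
have -> : 4 * c = c + c + (c + c) by ring.
apply: le_trans HH _; apply: eq_ler.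
transitivity (4 * `|al + be| ^+ 2 + 2 * (`|ga + de| ^+ 2 + `|ga - de| ^+ 2)); first by ring.
by rewrite parallelogram; ring.
Qed.

(** The diagonal overlaps of [a] with [u] and of [b] with [w] are at most [s]
    and [t].  By Bessel, whatever the off-diagonal overlaps add is paid for by
    a loss in the diagonal ones. *)
Lemma rotating_overlap (a b u w : 'cV[C]_d) (c s t : C) :
  ip a a = 1 -> ip b b = 1 -> ip a b = 0 -> 0 <= s -> 0 <= t ->
  ip u u = s ^+ 2 -> ip w w = t ^+ 2 ->
  (forall th, `|th| = 1 -> c <= `|ip (a + th *: b) (u + th *: w)| ^+ 2) ->
  c <= (s + t) ^+ 2.
Proof.
move=> a1 b1 ab s0 t0 us wt H.
apply: le_trans (phase_average (al := ip a u) (be := ip b w) (ga := ip a w)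
  (de := ip b u) _) _.
  move=> th th1; apply: le_trans (H th th1) _.
  apply: eq_ler; congr (`|_| ^+ 2).
  rewrite !(ipDl, ipDr, ipZl, ipZr) mulrA [th^* * th]mulrC -normCK th1; ring.
have := bessel u a1 b1 ab; have := bessel w a1 b1 ab; rewrite us wt => Bw Bu.
have As : `|ip a u| <= s.
  by rewrite -(ler_pXn2r (n := 2))// ?nnegrE//; apply: le_trans Bu; rewrite lerDl exprn_ge0.
have Bt : `|ip b w| <= t.
  by rewrite -(ler_pXn2r (n := 2))// ?nnegrE//; apply: le_trans Bw; rewrite lerDr exprn_ge0.
have X : `|ip a u + ip b w| ^+ 2 <= (`|ip a u| + `|ip b w|) ^+ 2.
  by rewrite ler_pXn2r// ?nnegrE ?addr_ge0// ler_normD.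
have Y : `|ip a u| * `|ip b w| <= s * t by apply: ler_pM.
apply: le_trans (lerD (lerD X (lexx _)) (lexx _)) _.
have -> : (s + t) ^+ 2 = s ^+ 2 + t ^+ 2 + (s * t + s * t) by ring.
apply: le_trans (lerD (lerD Bu Bw) (lerD Y Y)).
by apply: eq_ler; ring.
Qed.

Lemma rank1_adj x c : 0 <= c -> (c *: (x *m x^t*))^t* = c *: (x *m x^t*).
Proof.
move=> c0; rewrite linearZ /= map_mxZ trmxC_mul trmxCK; congr (_ *: _).
by apply/CrealP; exact: ger0_real.
Qed.

Lemma mul_rank1 (x y z t : 'cV[C]_d) :
  (x *m y^t*) *m (z *m t^t*) = ip y z *: (x *m t^t*).
Proof. by rewrite mulmxA -(mulmxA x) [y^t* *m z]mx11_scalar mul_mx_scalar -scalemxAl. Qed.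

(** The squared Frobenius norm of the difference of the pure states along [x]
    and [y]. *)
Lemma pure_state_distance x y (p N : C) : 0 < p -> 0 < N ->
  ip x x = p -> ip y y = N ->
  let H := p^-1 *: (x *m x^t*) - N^-1 *: (y *m y^t*) in
  \tr (H^t* *m H) = 2 - 2 * `|ip x y| ^+ 2 / (p * N).
Proof.
move=> p0 N0 xp yN H.
have -> : H^t* = H.
  by rewrite /H linearB /= map_mxB !rank1_adj// invr_ge0 ltW.
rewrite /H mulmxBl !mulmxBr -!scalemxAl -!scalemxAr !mul_rank1 !scalerA.
rewrite !linearB /= !mxtraceZ !trace_rank1 xp yN (ipC x y) normCK.
by field; rewrite !gt_eqF.
Qed.

Lemma ip_eigen (P : 'M[C]_d) (D : 'rV[C]_d) j : P \is unitarymx ->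
  ip (specvec P j) (specmx P D *m specvec P j) = D 0 j.
Proof. by move=> Pu; rewrite specmx_specvec// ipZr ip_specvec// eqxx mulr1. Qed.

End InnerProduct.

(** * Eigenvalue ratios of gentle effects *)

Section GentleMeasurements.
Local Open Scope complex_scope.
Local Open Scope sesquilinear_scope.
Variables (R : realType) (d : nat).
Implicit Types (x y : 'cV[R[i]]_d) (A E H rho : 'M[R[i]]_d).

Lemma ge0_complexP (z : R[i]) : 0 <= z -> exists2 r : R, 0 <= r & z = r%:C.
Proof.
move=> z0; exists (complex.Re z); last by rewrite RRe_real// ger0_real.
by move: z0; rewrite lecE => /andP[].
Qed.

Lemma Re_ge0 (z : R[i]) : 0 <= z -> 0 <= complex.Re z.
Proof. by move=> /ge0_complexP[r r0 ->]. Qed.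

Lemma sum_sqr_le (I : finType) (K : numDomainType) (f : I -> K) :
  (forall i, 0 <= f i) -> \sum_i f i ^+ 2 <= (\sum_i f i) ^+ 2.
Proof.
move=> f0; rewrite expr2 mulr_suml ler_sum// => i _.
by rewrite expr2 ler_wpM2l// (bigD1 i)//= lerDl sumr_ge0.
Qed.

Lemma trace_specmx (P : 'M[R[i]]_d) (D : 'rV[R[i]]_d) : P \is unitarymx ->
  \tr (specmx P D) = \sum_k D 0 k.
Proof.
move=> /unitarymxP Pu; rewrite /specmx -mulmxA mxtrace_mulC -mulmxA Pu mulmx1.
by rewrite /mxtrace; apply: eq_bigr => k _; rewrite mxE eqxx mulr1n.
Qed.

(** The nonnegative singular values have a sum of squares of at most the
    square of their sum.  For the difference of two pure states this loses a
    factor of the square root of 2 against the exact trace norm, which the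
    constant 64 absorbs. *)
Lemma frobenius_le_trace_norm H :
  complex.Re (\tr (H^t* *m H)) <= (2 * trace_norm H) ^+ 2 /\ 0 <= trace_norm H.
Proof.
set B := H^t* *m H.
have Bh : B^t* = B by rewrite /B trmxC_mul trmxCK.
have Bn : B \is normalmx by apply/normalmxP; rewrite Bh.
have Pu := spectral_unitarymx B.
have BE : B = specmx (spectralmx B) (spectral_diag B).
  by move: Bn => /orthomx_spectralP {1}->; rewrite invmx_unitary.
have D0 k : 0 <= spectral_diag B 0 k.
  have := ipxx_ge0 (H *m specvec (spectralmx B) k).
  rewrite -[H in ip (H *m _)]trmxCK -ip_adj mulmxA -/B {2}BE specmx_specvec//.
  by rewrite ipZr ip_specvec// eqxx mulr1.
have sD k : 0 <= sqrtC (spectral_diag B 0 k) by rewrite sqrtC_ge0.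
have absE : \tr (absmx H) = \sum_k sqrtC (spectral_diag B 0 k).
  rewrite /absmx -/B invmx_unitary// -/(specmx _ _) trace_specmx//.
  by apply: eq_bigr => k _; rewrite mxE.
have /ge0_complexP[r r0 rE] : 0 <= \sum_k sqrtC (spectral_diag B 0 k).
  by apply: sumr_ge0 => k _; exact: sD.
have tn : trace_norm H = r / 2 by rewrite /trace_norm absE rE.
split; last by rewrite tn divr_ge0.
have -> : 2 * trace_norm H = r by rewrite tn; field.
have -> : \tr B = \sum_k spectral_diag B 0 k by rewrite {1}BE trace_specmx.
have := sum_sqr_le sD; rewrite rE.
under eq_bigr do rewrite sqrtCK.
by rewrite -rmorphXn /= lecE => /andP[].
Qed.

Lemma psd_rank1 x (c : R[i]) : 0 <= c -> psdmx (c *: (x *m x^t*)).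
Proof.
move=> c0; split.
  exact: rank1_adj.
move=> v; rewrite -scalemxAr -scalemxAl mxE mulr_ge0//.
have -> : v^t* *m (x *m x^t*) *m v = (v^t* *m x) *m (x^t* *m v) by rewrite !mulmxA.
rewrite mxE big_ord1 -/(ip v x) -/(ip x v) (ipC v x) -normCK.
by rewrite exprn_ge0.
Qed.

(** On the pure state along [x] gentleness bounds the trace norm of the
    disturbance, hence its Frobenius norm, which determines the overlap. *)
Lemma gentle_overlap (T : Type) (alpha : R) (M : T -> 'M[R[i]]_d) (w : T) x (p N : R) :
  gentle alpha M -> 0 < p -> 0 < N ->
  ip x x = p%:C -> ip (M w *m x) (M w *m x) = N%:C ->
  (p * N * (1 - 2 * alpha ^+ 2))%:C <= `|ip x (M w *m x)| ^+ 2.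
Proof.
move=> gM p0 N0 xp yN; set y := M w *m x.
pose rho := (p^-1)%:C *: (x *m x^t*).
have rho_dens : density rho.
  split; first by apply: psd_rank1; rewrite ler0c invr_ge0 ltW.
  by rewrite /rho mxtraceZ trace_rank1 xp -rmorphM /= mulVf ?gt_eqF.
have trE : \tr (rho *m effect M w) = (p^-1 * N)%:C.
  rewrite /rho -scalemxAl mxtraceZ mxtrace_mulC trace_rank1_mul /effect -mulmxA.
  by rewrite ip_adj trmxCK yN rmorphM.
have trE0 : 0 < rtrace (rho *m effect M w).
  by rewrite /rtrace trE /= mulr_gt0// invr_gt0.
have postE : post_state M rho w = (N^-1)%:C *: (y *m y^t*).
  rewrite /post_state trE /rho -scalemxAr -scalemxAl scalerA.
  rewrite /y trmxC_mul !mulmxA; congr (_ *: _).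
  rewrite -fmorphV -rmorphM /=; congr (_%:C); field.
  by rewrite !gt_eqF.
have := gM rho w rho_dens trE0; rewrite postE => tn.
have [fr tn0] := frobenius_le_trace_norm (rho - (N^-1)%:C *: (y *m y^t*)).
have pC : 0 < p%:C :> R[i] by rewrite ltcR.
have NC : 0 < N%:C :> R[i] by rewrite ltcR.
have := pure_state_distance pC NC xp yN; rewrite -!fmorphV /= => trH.
move: fr; rewrite trH => fr {trH}.
have [F F0 FE] := ge0_complexP (exprn_ge0 2 (normr_ge0 (ip x y))).
rewrite FE lecR.
have : 2 - 2 * F / (p * N) <= 4 * alpha ^+ 2.
  move: fr; rewrite FE -[2]/(2%:R) -(rmorph_nat (real_complex R)) -!rmorphM
    -fmorphV -!rmorphM -rmorphB /=.
  move=> /le_trans; apply.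
  rewrite exprMn -natrX ler_wpM2l// ler_sqr ?nnegrE//.
  exact: le_trans tn.
have pN : 0 < p * N by rewrite mulr_gt0.
rewrite -(ler_pM2r pN) mulrBl mulfVK ?gt_eqF// => h.
lra.
Qed.

Definition kappa (alpha : R) : R := ((1 + 2 * alpha) / (1 - 2 * alpha)) ^+ 2.

(** Applied to the superpositions of [a] and [b], the lower bound on overlaps
    and [rotating_overlap] give, with [s] and [t] the roots of the eigenvalues,
    [(s - t) ^+ 2 <= 4 * alpha ^+ 2 * (s ^+ 2 + t ^+ 2)]. *)
Lemma gentle_eigenvalue_ratio (T : Type) (alpha : R) (M : T -> 'M[R[i]]_d) (w : T)
    (a b : 'cV[R[i]]_d) (la lb : R) :
  0 <= alpha < 2^-1 -> gentle alpha M -> 0 <= la -> 0 <= lb ->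
  ip a a = 1 -> ip b b = 1 -> ip a b = 0 ->
  effect M w *m a = la%:C *: a -> effect M w *m b = lb%:C *: b ->
  la <= kappa alpha * lb.
Proof.
move=> /andP[al0 al2] gM la0 lb0 a1 b1 ab Ea Eb.
have k0 : 0 <= kappa alpha by rewrite sqr_ge0.
have [->|lap] := eqVneq la 0; first by rewrite mulr_ge0.
have {}lap : 0 < la by rewrite lt_def lap.
have Mip x y : ip (M w *m x) (M w *m y) = ip x (effect M w *m y).
  by rewrite /effect -mulmxA [RHS]ip_adj trmxCK.
have uu : ip (M w *m a) (M w *m a) = (Num.sqrt la)%:C ^+ 2.
  by rewrite Mip Ea ipZr a1 mulr1 -rmorphXn /= sqr_sqrtr.
have ww : ip (M w *m b) (M w *m b) = (Num.sqrt lb)%:C ^+ 2.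
  by rewrite Mip Eb ipZr b1 mulr1 -rmorphXn /= sqr_sqrtr.
have ba : ip b a = 0 by rewrite ipC ab conjC0.
have := rotating_overlap (c := (2 * (la + lb) * (1 - 2 * alpha ^+ 2))%:C)
  a1 b1 ab _ _ uu ww _; rewrite !ler0c !sqrtr_ge0 => /(_ isT isT) H.
have {H} : 2 * (la + lb) * (1 - 2 * alpha ^+ 2) <= (Num.sqrt la + Num.sqrt lb) ^+ 2.
  rewrite -lecR rmorphXn rmorphD /=; apply: H => th th1.
  have thth : th^*%R * th = 1 by rewrite mulrC -normCK th1 expr1n.
  have := @gentle_overlap _ _ _ w (a + th *: b) 2 (la + lb) gM _ _ _ _.
  rewrite mulmxDr -scalemxAr; apply => //.
  - by rewrite ltr_wpDr.
  - rewrite !(ipDl, ipDr, ipZl, ipZr) ab ba a1 b1 !mulr0 addr0 add0r mulr1 thth.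
    by rewrite rmorph_nat.
  - rewrite !(ipDl, ipDr, ipZl, ipZr) !Mip Ea Eb !ipZr a1 b1 ab ba !mulr0 addr0 add0r !mulr1.
    by rewrite mulrA thth mul1r rmorphD /=.
have := sqrtr_ge0 la; have := sqrtr_ge0 lb.
have := sqr_sqrtr la0; have := sqr_sqrtr lb0.
set s := Num.sqrt la; set t := Num.sqrt lb => <- <- t0 s0 h.
(* The left-hand side of [h] exceeds its right-hand side by
   [(s - t) ^+ 2 - 4 * alpha ^+ 2 * (s ^+ 2 + t ^+ 2)]. *)
have h2 : (s - t) ^+ 2 <= (2 * alpha * (s + t)) ^+ 2.
  by have : 0 <= alpha ^+ 2 * (s * t); [rewrite !mulr_ge0 | lra].
have h3 : s - t <= 2 * alpha * (s + t).
  have [st|/ltW st] := leP (s - t) 0.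
    by apply: le_trans st _; rewrite !mulr_ge0// addr_ge0.
  by rewrite -(ler_pXn2r (n := 2))// nnegrE// !mulr_ge0// addr_ge0.
have q0 : 0 < 1 - 2 * alpha by lra.
rewrite /kappa -exprMn ler_sqr ?nnegrE//; last first.
  by rewrite !mulr_ge0// ?invr_ge0; lra.
rewrite mulrAC ler_pdivlMr//; lra.
Qed.

(** * The cone of matrices with bounded eigenvalue ratio *)

Lemma psdmx_ipP A : psdmx A <-> A^t* = A /\ forall v, 0 <= ip v (A *m v).
Proof. by rewrite /psdmx /ip; split=> -[? h]; split=> // v; rewrite ?mulmxA // -mulmxA. Qed.

Lemma norm2E x : (norm2 x ^+ 2)%:C = ip x x.
Proof.
rewrite /norm2 sqr_sqrtr; last by apply: sumr_ge0 => k _; rewrite sqr_ge0.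
rewrite rmorph_sum ipxx; apply: eq_bigr => k _.
by rewrite rmorphXn.
Qed.

(** In the eigenbasis each coordinate is multiplied by a number of modulus at
    most 1. *)
Lemma opnorm_specmx_le1 (P : 'M[R[i]]_d) (D : 'rV[R[i]]_d) :
  P \is unitarymx -> (forall k, 0 <= D 0 k <= 1) -> opnorm (specmx P D) <= 1.
Proof.
move=> Pu D01; apply: ge_sup.
  exists (norm2 (specmx P D *m 0)), 0 => //=.
  rewrite /norm2 big1 ?sqrtr0// => k _.
  by rewrite mxE Normc.normc0 expr0n.
move=> _ [v /= v1 <-].
apply: le_trans v1; rewrite -(ler_pXn2r (n := 2))// ?nnegrE ?sqrtr_ge0//.
rewrite -lecR !norm2E -[leLHS](ip_unitary _ Pu) -[leRHS](ip_unitary _ Pu).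
have -> : P *m (specmx P D *m v) = diag_mx D *m (P *m v).
  by move/unitarymxP: Pu => Pu; rewrite /specmx !mulmxA Pu mul1mx.
rewrite !ipxx; apply: ler_sum => k _.
rewrite mul_diag_mx [X in `|X|]mxE normrM exprMn ler_piMl ?exprn_ge0//.
by have /andP[D0 D1] := D01 k; rewrite ger0_norm// exprn_ile1.
Qed.

(** No eigenvalue exceeds [K] times another one.  Quadratic forms at unnormalized
    vectors express this by inequalities that are linear in [E], so it is stable
    under sums and limits. *)
Definition balanced (K : R) E : Prop := psdmx E /\
  forall x y, ip x (E *m x) * ip y y <= K%:C * (ip y (E *m y) * ip x x).

Lemma psdmx_specmx E : psdmx E -> exists P (l : 'I_d -> R),
  [/\ P \is unitarymx, forall k, 0 <= l k & E = specmx P (\row_k (l k)%:C)].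
Proof.
move=> /psdmx_ipP[Eh E0]; have [P [D [Pu ED]]] := hermitian_specmx Eh.
have D0 k : 0 <= D 0 k.
  by have := E0 (specvec P k); rewrite ED ip_eigen.
have DE : D = \row_k (complex.Re (D 0 k))%:C.
  by apply/rowP => k; rewrite mxE RRe_real// ger0_real.
exists P, (fun k => complex.Re (D 0 k)); split; [exact: Pu | | by rewrite -DE].
by move=> k; exact: Re_ge0.
Qed.

Lemma psdmx_of_specmx (P : 'M[R[i]]_d) (l : 'I_d -> R) : (forall k, 0 <= l k) ->
  psdmx (specmx P (\row_k (l k)%:C)).
Proof.
move=> l0; apply/psdmx_ipP; split.
  by apply: specmx_adj => k; rewrite mxE; apply: ger0_real; rewrite ler0c.
move=> v; rewrite ip_specmx sumr_ge0// => k _.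
by rewrite mxE mulr_ge0 ?exprn_ge0// ler0c.
Qed.

Lemma balanced_specmx (K : R) (P : 'M[R[i]]_d) (l : 'I_d -> R) :
  P \is unitarymx -> (forall k, 0 <= l k) -> (forall i j, l i <= K * l j) ->
  balanced K (specmx P (\row_k (l k)%:C)).
Proof.
move=> Pu l0 lK; split; first exact: psdmx_of_specmx.
move=> x y; rewrite -(ip_unitary x Pu) -(ip_unitary y Pu) !ip_specmx !ipxx.
have key (a b : R[i]) (p q : R) : 0 <= a -> 0 <= b -> p <= K * q ->
    p%:C * a * b <= K%:C * (q%:C * b * a).
  move=> a0 b0 pq; rewrite -mulrA (_ : _ * (_ * _ * _) = (K * q)%:C * (a * b)).
    by rewrite ler_wpM2r ?lecR// mulr_ge0.
  by rewrite rmorphM /=; ring.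
rewrite !big_distrlr [X in _ <= _ * X]exchange_big /= mulr_sumr.
apply: ler_sum => i _; rewrite mulr_sumr; apply: ler_sum => j _; rewrite !mxE.
by apply: key; rewrite ?exprn_ge0.
Qed.

Lemma effect_psd (T : Type) (M : T -> 'M[R[i]]_d) w : psdmx (effect M w).
Proof.
apply/psdmx_ipP; split; first by rewrite /effect trmxC_mul trmxCK.
by move=> v; rewrite /effect -mulmxA ip_adj trmxCK ipxx_ge0.
Qed.

Lemma kappa_ge1 (alpha : R) : 0 <= alpha < 2^-1 -> 1 <= kappa alpha.
Proof.
move=> /andP[a0 a2]; have q0 : 0 < 1 - 2 * alpha by lra.
by rewrite /kappa exprn_ege1// ler_pdivlMr//; lra.
Qed.

Lemma gentle_effect_balanced (T : Type) (alpha : R) (M : T -> 'M[R[i]]_d) (w : T) :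
  0 <= alpha < 2^-1 -> gentle alpha M -> balanced (kappa alpha) (effect M w).
Proof.
move=> al gM; have [P [l [Pu l0 El]]] := psdmx_specmx (effect_psd M w).
rewrite El; apply: balanced_specmx => // i j.
have [->|ij] := eqVneq i j; first by rewrite ler_peMl ?kappa_ge1.
apply: (@gentle_eigenvalue_ratio _ _ M w (specvec P i) (specvec P j)) => //.
- by rewrite ip_specvec// eqxx.
- by rewrite ip_specvec// eqxx.
- by rewrite ip_specvec// (negPf ij).
- by rewrite El specmx_specvec// mxE.
- by rewrite El specmx_specvec// mxE.
Qed.

Lemma balanced_sum (K : R) (I : Type) (r : seq I) (F : I -> 'M[R[i]]_d) :
  (forall i, balanced K (F i)) -> balanced K (\sum_(i <- r) F i).
Proof.
move=> FB; split.
  apply/psdmx_ipP; split.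
    rewrite linear_sum rmorph_sum /=; apply: eq_bigr => i _.
    by have [[]] := FB i.
  move=> v; rewrite mulmx_suml /ip mulmx_sumr summxE sumr_ge0// => i _.
  by have [/psdmx_ipP[_ h] _] := FB i; exact: h.
move=> x y.
have E v : ip v ((\sum_(i <- r) F i) *m v) = \sum_(i <- r) ip v (F i *m v).
  by rewrite mulmx_suml /ip mulmx_sumr summxE.
rewrite !E !mulr_suml mulr_sumr; apply: ler_sum => i _.
by have [_] := FB i.
Qed.

(** [l] is the least eigenvalue, and [A] is [E - l] rescaled by the largest
    value, [(K - 1) * l], that its eigenvalues can take. *)
Lemma balanced_decomposition (K : R) E : 1 <= K -> (0 < d)%N -> balanced K E ->
  exists (l : R) A, [/\ 0 <= l, psdmx A, opnorm A <= 1 &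
    E = l%:C%:M + ((K - 1) * l)%:C *: A].
Proof.
move=> K1 d0 [psdE bE].
have [P [m [Pu m0 Em]]] := psdmx_specmx psdE.
have mK i j : m i <= K * m j.
  have := bE (specvec P i) (specvec P j).
  rewrite Em !ip_eigen// !ip_specvec// !eqxx !mulr1 !mxE -rmorphM lecR.
  by [].
have [k km] : exists k, forall j, m k <= m j.
  pose k := [arg min_(i < Ordinal d0) m i]%O.
  by exists k; rewrite /k; case: arg_minP => // i _ h j; apply: h.
pose l := m k; pose c := (K - 1) * l.
have c0 : 0 <= c by apply: mulr_ge0; [rewrite subr_ge0 | exact: m0].
have mlc j : m j - l <= c by have := mK j k; rewrite -/l /c; lra.
(* If [c = 0] then all eigenvalues equal [l], and [A = 0] by the convention for
   division by 0. *)
have a01 j : 0 <= (m j - l) / c <= 1.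
  have [->|cn] := eqVneq c 0; first by rewrite invr0 mulr0 lexx ler01.
  have cp : 0 < c by rewrite lt_def cn.
  by rewrite ler_pdivrMr// mul1r mlc divr_ge0// subr_ge0 km.
have ca j : c * ((m j - l) / c) = m j - l.
  have [c00|cn] := eqVneq c 0; last by rewrite mulrCA divff// mulr1.
  have := mlc j; have := km j; rewrite -/l c00; lra.
exists l, (specmx P (\row_j ((m j - l) / c)%:C)); split.
- exact: m0.
- by apply: psdmx_of_specmx => j; have /andP[] := a01 j.
- by apply: opnorm_specmx_le1 => // j; rewrite mxE ler0c lecR.
rewrite -/c Em.
have -> : l%:C%:M = specmx P (const_mx l%:C).
  have PP : P^t* *m P = 1%:M.
    by move: Pu; rewrite -trmxC_unitary => /unitarymxP; rewrite trmxCK.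
  by rewrite /specmx diag_const_mx mul_mx_scalar -scalemxAl PP scalemx1.
rewrite /specmx scalemxAl scalemxAr -mulmxDl -mulmxDr; congr (_ *m _ *m _).
apply/matrixP => i j; rewrite !mxE.
case: eqVneq => _; last by rewrite !mulr0n mulr0 addr0.
rewrite !mulr1n -rmorphM -rmorphD /= ca; congr (_%:C); lra.
Qed.

Lemma ge0_approx (z : R[i]) :
  (forall e : R, 0 < e -> exists2 z', 0 <= z' & `|z - z'| <= e%:C) -> 0 <= z.
Proof.
move=> H; case: z H => a b H; rewrite lecE /=.
have {}H e : 0 < e -> `|b| <= e /\ 0 <= a + e.
  move=> e0; have [z' /ge0_complexP[r r0 ->]] := H e e0.
  rewrite normc_def lecR /= oppr0 addr0 => h; split.
    apply: le_trans h; rewrite -sqrtr_sqr ler_wsqrtr// lerDr sqr_ge0//.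
  have : `|a - r| <= e.
    by apply: le_trans h; rewrite -sqrtr_sqr ler_wsqrtr// lerDl sqr_ge0.
  by rewrite ler_norml => /andP[? _]; lra.
apply/andP; split.
  rewrite -normr_eq0 eq_le normr_ge0 andbT; apply/ler_addgt0Pr => e e0.
  by rewrite add0r; have [] := H e e0.
by apply/ler_addgt0Pr => e e0; have [] := H e e0.
Qed.

Lemma ip_entry_bound x H (e : R) : (forall i j, `|H i j| <= e%:C) ->
  `|ip x (H *m x)| <= e%:C * (\sum_i `|x i 0|) ^+ 2.
Proof.
move=> He; rewrite ipE expr2 big_distrlr /= mulr_sumr.
apply: le_trans (ler_norm_sum _ _ _) _; apply: ler_sum => i _.
rewrite normrM norm_conjC mxE mulr_sumr.
apply: le_trans (ler_wpM2l _ (ler_norm_sum _ _ _)) _ => //.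
rewrite mulr_sumr; apply: ler_sum => j _.
by rewrite normrM mulrCA ler_wpM2r// mulr_ge0.
Qed.

(** Each inequality compares entries of [E] linearly, so an entrywise error [e]
    changes it by at most a multiple of [e] that depends on the vectors only. *)
Lemma balanced_closed (K : R) E : 0 <= K -> E^t* = E ->
  (forall e : R, 0 < e -> exists E', balanced K E' /\
     forall i j, `|(E - E') i j| <= e%:C) -> balanced K E.
Proof.
move=> K0 Eh H.
have s0 x : exists2 r : R, 0 <= r & (\sum_i `|x i 0|) ^+ 2 = r%:C :> R[i].
  by apply: ge0_complexP; rewrite exprn_ge0// sumr_ge0.
have ip0 x : exists2 r : R, 0 <= r & ip x x = r%:C.
  by apply: ge0_complexP; exact: ipxx_ge0.
have small (B e : R) : 0 <= B -> 0 < e -> exists2 e', 0 < e' & e' * B <= e.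
  move=> B0 e0; exists (e / (B + 1)); first by rewrite divr_gt0// ltr_wpDl.
  by rewrite mulrAC ler_pdivrMr ?ltr_wpDl// ler_wpM2l ?ltW//; lra.
split.
  apply/psdmx_ipP; split=> // v; apply: ge0_approx => e e0.
  have [s sge0 sE] := s0 v; have [e' e'0 e'e] := small s e sge0 e0.
  have [E' [[/psdmx_ipP[_ E'0] _] hE']] := H e' e'0.
  exists (ip v (E' *m v)); first exact: E'0.
  rewrite -ipBr -mulmxBl; apply: le_trans (ip_entry_bound _ hE') _.
  by rewrite sE -rmorphM /= lecR.
move=> x y; rewrite -subr_ge0; apply: ge0_approx => e e0.
have [sx sx0 sxE] := s0 x; have [sy sy0 syE] := s0 y.
have [px px0 pxE] := ip0 x; have [py py0 pyE] := ip0 y.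
have B0 : 0 <= K * (sy * px) + sx * py by rewrite addr_ge0// !mulr_ge0.
have [e' e'0 e'e] := small _ e B0 e0.
have [E' [[_ bE'] hE']] := H e' e'0.
exists (K%:C * (ip y (E' *m y) * ip x x) - ip x (E' *m x) * ip y y).
  by rewrite subr_ge0.
set z := (X in `|X|).
have -> : z = K%:C * (ip y ((E - E') *m y) * ip x x) - ip x ((E - E') *m x) * ip y y.
  rewrite mulmxBl mulmxBl ipBr ipBr /z mulrBl mulrBl mulrBr opprB.
  by rewrite [X in _ + X]addrC addrACA; congr (_ + _); rewrite opprB addrC.
apply: le_trans (ler_normB _ _) _; rewrite !normrM pxE pyE.
have nC (r : R) : 0 <= r -> `|r%:C| = r%:C :> R[i] by move=> r0; rewrite ger0_norm// ler0c.
rewrite !nC//.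
have hx := ip_entry_bound x hE'; have hy := ip_entry_bound y hE'.
rewrite sxE in hx; rewrite syE in hy.
apply: le_trans (_ : K%:C * (e'%:C * sy%:C * px%:C) + e'%:C * sx%:C * py%:C <= _).
  by apply: lerD; [apply: ler_wpM2l; rewrite ?ler0c//|]; apply: ler_wpM2r; rewrite ?ler0c.
rewrite -!rmorphM -rmorphD /= lecR; lra.
Qed.

Lemma measurement_approx (T : countType) (M : T -> 'M[R[i]]_d) : measurement M ->
  forall (S : {fset T}) (e : R), 0 < e -> exists F : {fset T}, (S `<=` F)%fset /\
    forall i j, `|(1%:M - \sum_(w <- F) effect M w) i j| <= e%:C.
Proof.
move=> mM S e e0.
have eC : 0 < e%:C :> R[i] by rewrite ltcR.
have [A _ hA] : totally (fun F =>
    ball (1%:M : 'M[R[i] : numFieldType]_d) e%:C (partial_sum (effect M) F)).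
  by have := mM _ (nbhsx_ballx (1%:M : 'M[R[i] : numFieldType]_d) e%:C eC); apply.
exists (S `|` A)%fset; split; first exact: fsubsetUl.
have /= := hA (S `|` A)%fset (fsubsetUr _ _).
move=> [_ h] i j; have := h i j; rewrite big_seq_fsetE /= => hij.
move: hij; rewrite /ball /= /ball_ /partial_sum => /ltW.
by rewrite [in X in _ -> X]mxE [in X in _ -> `|_ + X| <= _]mxE.
Qed.

(** The remainder is the limit of the sums of the effects outside [S]. *)
Lemma remainder_balanced (K : R) (T : countType) (M : T -> 'M[R[i]]_d) (S : {fset T}) :
  0 <= K -> measurement M -> (forall w, balanced K (effect M w)) ->
  balanced K (1%:M - \sum_(w <- S) effect M w).
Proof.
move=> K0 mM bM; apply: balanced_closed => //.
  have [[h _] _] := balanced_sum S bM.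
  by rewrite linearB rmorphB /= h trmx1 map_mx1.
move=> e e0; have [F [SF hF]] := measurement_approx mM S e0.
exists (\sum_(w <- (F `\` S)%fset) effect M w); split; first exact: balanced_sum.
suff -> : 1%:M - \sum_(w <- S) effect M w - \sum_(w <- (F `\` S)%fset) effect M w
  = 1%:M - \sum_(w <- F) effect M w by [].
rewrite -addrA -opprD; congr (_ - _).
rewrite [RHS](big_fsetID _ (mem S)) /=; congr (_ + _); apply: congr_big => //.
  congr (enum_fset _); apply/fsetP => w; rewrite !inE /=.
  by case: (boolP (w \in S)) => [/(fsubsetP SF) ->|]; rewrite ?andbF.
by congr (enum_fset _); apply/fsetP => w; rewrite !inE /= andbC.
Qed.

End GentleMeasurements.

(** * Log-sum inequality and chain rule *)

Section Jeffreys.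
Variable R : realType.
Implicit Types (x y : R).

(** The contribution of one outcome to the symmetrized Kullback-Leibler
    divergence, also when both probabilities vanish. *)
Definition jeffreys x y : R := (x - y) * ln (x / y).

Lemma ln_quot x y : 0 < x -> 0 < y -> ln (x / y) = ln x - ln y.
Proof. by move=> x0 y0; rewrite ln_div. Qed.

Lemma ln_quot_le x y : 0 < x -> 0 < y -> ln (x / y) <= (x - y) / y.
Proof.
move=> x0 y0; have -> : x / y = 1 + (x - y) / y by field; rewrite gt_eqF.
by apply: le_ln1Dx; rewrite ltr_pdivlMr//; lra.
Qed.

Lemma jeffreys_ge0 x y : 0 <= x -> 0 <= y -> 0 <= jeffreys x y.
Proof.
rewrite le_eqVlt => /predU1P[<- _|x0]; first by rewrite /jeffreys mul0r ln0// mulr0.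
rewrite le_eqVlt => /predU1P[<-|y0]; first by rewrite /jeffreys invr0 mulr0 ln0// mulr0.
rewrite /jeffreys ln_quot//; have [xy|/ltW xy] := leP x y.
  by rewrite mulr_le0// subr_le0// ler_ln.
by rewrite mulr_ge0// subr_ge0// ler_ln.
Qed.

Lemma jeffreysxx x : 0 <= x -> jeffreys x x = 0.
Proof. by rewrite /jeffreys subrr mul0r. Qed.

(** For [y <= x] this is [ln (x / y) <= (x - y) / y]; the other case is
    symmetric. *)
Lemma jeffreys_le_sqr x y l : 0 < l -> l <= x -> l <= y ->
  jeffreys x y <= (x - y) ^+ 2 / l.
Proof.
move=> l0 lx ly; have x0 := lt_le_trans l0 lx; have y0 := lt_le_trans l0 ly.
have aux a b : 0 < b -> l <= b -> b <= a -> (a - b) * ln (a / b) <= (a - b) ^+ 2 / l.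
  move=> b0 lb ba; have a0 := lt_le_trans b0 ba; have ab0 : 0 <= a - b by rewrite subr_ge0.
  rewrite expr2 -mulrA ler_wpM2l//; apply: le_trans (ln_quot_le a0 b0) _.
  by rewrite ler_wpM2l// lef_pV2.
rewrite /jeffreys; have [xy|/ltW xy] := leP y x; first exact: aux.
have := aux y x x0 lx xy; rewrite -sqrrN opprB; apply: le_trans.
rewrite !ln_quot//; apply: eq_ler; ring.
Qed.

Lemma jeffreysZ c x y : 0 < c -> jeffreys (c * x) (c * y) = c * jeffreys x y.
Proof.
move=> c0; rewrite /jeffreys -mulrBr -mulrA; congr (_ * (_ * ln _)).
by rewrite invfM mulrACA mulfV ?gt_eqF// mul1r.
Qed.

(** With [X] and [Y] the two sums, [ln u <= u - 1] at [u = y i * X / (x i * Y)]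
    bounds the difference of the two sides below by the sum of
    [x i - y i * X / Y], which vanishes. *)
Lemma log_sum (I : finType) (P : pred I) (x y : I -> R) :
  (forall i, P i -> 0 <= x i) -> (forall i, P i -> 0 <= y i) ->
  (forall i, P i -> (x i == 0) = (y i == 0)) ->
  (\sum_(i | P i) x i) * ln ((\sum_(i | P i) x i) / (\sum_(i | P i) y i)) <=
  \sum_(i | P i) x i * ln (x i / y i).
Proof.
move=> x0 y0 xy; set X := \sum_(i | P i) x i; set Y := \sum_(i | P i) y i.
have X0 : 0 <= X by exact: sumr_ge0.
have Y0 : 0 <= Y by exact: sumr_ge0.
have XY : X = 0 <-> Y = 0.
  split=> /eqP; rewrite psumr_eq0// => /allP h; apply/eqP; rewrite psumr_eq0//;
  by apply/allP => i ii; have := h i ii; case: (boolP (P i)) => //= Pi; rewrite xy.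
have [X00|Xn] := eqVneq X 0.
  rewrite X00 mul0r; have := X00; rewrite /X => /eqP; rewrite psumr_eq0// => /allP h.
  apply: sumr_ge0 => i Pi; have := h i (mem_index_enum _); rewrite Pi /= => /eqP ->.
  by rewrite mul0r.
have Xp : 0 < X by rewrite lt_def Xn.
have Yp : 0 < Y by rewrite lt_def Y0 andbT; apply: contra Xn => /eqP /XY ->.
rewrite -subr_ge0 mulr_suml -sumrB.
apply: le_trans (_ : \sum_(i | P i) (x i - y i * (X / Y)) <= _).
  by rewrite sumrB -mulr_suml -/X -/Y mulrCA mulfV ?gt_eqF// mulr1 subrr.
apply: ler_sum => i Pi; have [xi|xin] := eqVneq (x i) 0.
  have := xy i Pi; rewrite xi eqxx => /esym/eqP ->.
  by rewrite !mul0r subrr.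
have xp : 0 < x i by rewrite lt_def xin x0.
have yp : 0 < y i by rewrite lt_def y0// andbT -xy.
have yXY : 0 < y i * (X / Y) by rewrite mulr_gt0// divr_gt0.
have := ln_quot_le yXY xp.
rewrite -mulrBr (_ : ln (x i / y i) - ln (X / Y) = - ln (y i * (X / Y) / x i)).
  move=> h; have : x i * ln (y i * (X / Y) / x i) <= x i * ((y i * (X / Y) - x i) / x i).
    by rewrite ler_pM2l.
  by rewrite [leRHS]mulrCA mulfV ?gt_eqF// mulr1 mulrN; lra.
have lnyXY : ln (y i * (X / Y)) = ln (y i) + ln (X / Y).
  by rewrite lnM ?posrE ?divr_gt0.
rewrite (ln_quot yXY xp) (ln_quot xp yp) lnyXY; ring.
Qed.

Lemma jeffreysE x y : 0 <= x -> 0 <= y -> (x == 0) = (y == 0) ->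
  jeffreys x y = x * ln (x / y) + y * ln (y / x).
Proof.
move=> x0 y0; have [->|xn] := eqVneq x 0 => /esym.
  by move=> /eqP ->; rewrite /jeffreys subrr !mul0r addr0.
move=> /negbT yn; have xp : 0 < x by rewrite lt_def xn.
have yp : 0 < y by rewrite lt_def yn.
by rewrite /jeffreys !ln_quot//; ring.
Qed.

(** The function [jeffreys] is convex and homogeneous of degree 1, hence
    subadditive. *)
Lemma jeffreys_sum (I : finType) (P : pred I) (x y : I -> R) :
  (forall i, P i -> 0 <= x i) -> (forall i, P i -> 0 <= y i) ->
  (forall i, P i -> (x i == 0) = (y i == 0)) ->
  jeffreys (\sum_(i | P i) x i) (\sum_(i | P i) y i) <=
  \sum_(i | P i) jeffreys (x i) (y i).
Proof.
move=> x0 y0 xy; rewrite jeffreysE ?sumr_ge0//; last first.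
  rewrite !psumr_eq0//; apply: eq_all => i /=.
  by case: (boolP (P i)) => //= Pi; rewrite xy.
rewrite [leRHS](eq_bigr (fun i => x i * ln (x i / y i) + y i * ln (y i / x i))).
  by rewrite big_split lerD// log_sum// => i Pi; rewrite xy.
by move=> i Pi; rewrite jeffreysE ?x0 ?y0 ?xy.
Qed.

Lemma ln_prod (I : finType) (x : I -> R) : (forall i, 0 < x i) ->
  ln (\prod_i x i) = \sum_i ln (x i).
Proof.
move=> x0; suff [] : 0 < \prod_i x i /\ ln (\prod_i x i) = \sum_i ln (x i) by [].
elim/big_ind2 : _ => [|a b c e [a0 ab] [c0 ce]|i _]; first by rewrite ln1.
  by rewrite mulr_gt0// lnM ?posrE// ab ce.
by split.
Qed.

Lemma prod_marginal (I J : finType) (p : I -> J -> R) (h : J -> R) (i : I) :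
  (forall k, k != i -> \sum_j p k j = 1) ->
  \sum_(f : {ffun I -> J}) (\prod_k p k (f k)) * h (f i) = \sum_j p i j * h j.
Proof.
move=> p1; pose q k j := if k == i then p k j * h j else p k j.
transitivity (\sum_(f : {ffun I -> J}) \prod_k q k (f k)).
  apply: eq_bigr => f _; rewrite (bigD1 i)//= [RHS](bigD1 i)//= /q eqxx mulrAC.
  by congr (_ * _); apply: eq_bigr => k /negPf ->.
rewrite -(bigA_distr_bigA q) (bigD1 i)//= [X in _ * X]big1 ?mulr1.
  by apply: eq_bigr => j _; rewrite /q eqxx.
by move=> k ki; rewrite -[RHS](p1 k ki); apply: eq_bigr => j _; rewrite /q (negPf ki).
Qed.

(** The logarithm of the likelihood ratio is a sum over the factors, and each
    summand depends on one coordinate only, so the other factors sum to 1. *)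
Lemma jeffreys_product (I J : finType) (p q : I -> J -> R) :
  (forall i j, 0 <= p i j) -> (forall i j, 0 <= q i j) ->
  (forall i j, (p i j == 0) = (q i j == 0)) ->
  (forall i, \sum_j p i j = 1) -> (forall i, \sum_j q i j = 1) ->
  \sum_(f : {ffun I -> J}) jeffreys (\prod_i p i (f i)) (\prod_i q i (f i)) =
  \sum_i \sum_j jeffreys (p i j) (q i j).
Proof.
move=> p0 q0 pq p1 q1.
transitivity (\sum_(f : {ffun I -> J}) \sum_i
    ((\prod_k p k (f k)) * ln (p i (f i) / q i (f i)) -
     (\prod_k q k (f k)) * ln (p i (f i) / q i (f i)))).
  apply: eq_bigr => f _; rewrite sumrB -!mulr_sumr -mulrBl /jeffreys.
  have [/existsP[k /eqP pk]|] := boolP [exists k, p k (f k) == 0].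
    have /eqP qk : q k (f k) == 0 by rewrite -pq pk.
    by rewrite (bigD1 k)//= pk mul0r (bigD1 k)//= qk mul0r subrr !mul0r.
  rewrite negb_exists => /forallP n0; congr (_ * _).
  have pp k : 0 < p k (f k) by rewrite lt_def n0 p0.
  have qp k : 0 < q k (f k) by rewrite lt_def -pq n0 q0.
  rewrite -prodf_div ln_prod// => k; exact: divr_gt0.
rewrite exchange_big; apply: eq_bigr => i _ /=.
rewrite sumrB (prod_marginal (fun j => ln (p i j / q i j)))//.
rewrite (prod_marginal (fun j => ln (p i j / q i j)))// -sumrB.
by apply: eq_bigr => j _; rewrite -mulrBl.
Qed.

Lemma xlnx_quot_ge x y : 0 <= x -> 0 <= y -> (x == 0) = (y == 0) ->
  x - y <= x * ln (x / y).
Proof.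
move=> x0 y0; have [->|xn] := eqVneq x 0 => /esym.
  by move=> /eqP ->; rewrite !mul0r subr0.
move=> /negbT yn; have xp : 0 < x by rewrite lt_def xn.
have yp : 0 < y by rewrite lt_def yn.
have := ln_quot_le yp xp; rewrite -(ler_pM2l xp) mulrCA mulfV ?gt_eqF// mulr1.
by rewrite !ln_quot//; lra.
Qed.

End Jeffreys.

(** * The divergence as a sum of nonnegative terms *)

Section KullbackLeibler.
Variable R : realType.
Local Open Scope ereal_scope.

(** Adding [q x] to each term of the divergence makes it nonnegative, because
    [x * ln (x / y) >= x - y]. *)
Lemma kl_divE (T : countType) (p q : T -> R) :
  (forall x, 0 <= p x)%R -> (forall x, 0 <= q x)%R ->
  (forall x, (p x == 0%R) = (q x == 0%R)) ->
  \esum_(x in [set: T]) (p x * ln (p x / q x) + q x)%:E < +oo ->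
  \esum_(x in [set: T]) (q x)%:E < +oo ->
  kl_div p q = \esum_(x in [set: T]) (p x * ln (p x / q x) + q x)%:E
             - \esum_(x in [set: T]) (q x)%:E.
Proof.
move=> p0 q0 pq sF sq; rewrite /kl_div; case: asboolP; last first.
  by case=> x /eqP qx; apply/eqP; rewrite pq.
move=> _; have F0 x : 0 <= (p x * ln (p x / q x) + q x)%:E.
  by rewrite lee_fin; have := xlnx_quot_ge (p0 x) (q0 x) (pq x); have := p0 x; lra.
have G0 x : 0 <= (q x)%:E by rewrite lee_fin.
have -> : (fun x => (p x * ln (p x / q x))%:E) =
    (fun x => (p x * ln (p x / q x) + q x)%:E) \- (fun x => (q x)%:E).
  by apply/funext => x /=; rewrite -EFinB addrK.
apply: esumB => //.
- by rewrite /esum.summable; under eq_esum do rewrite gee0_abs//.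
- by rewrite /esum.summable; under eq_esum do rewrite gee0_abs//.
Qed.

(** Once all four sums in the two divergences are finite they can be
    rearranged; if the right-hand side is infinite there is nothing to prove. *)
Lemma kl_sym_le_jeffreys (T : countType) (p q : T -> R) :
  (forall x, 0 <= p x)%R -> (forall x, 0 <= q x)%R ->
  (forall x, (p x == 0%R) = (q x == 0%R)) ->
  \esum_(x in [set: T]) (p x)%:E < +oo -> \esum_(x in [set: T]) (q x)%:E < +oo ->
  kl_sym p q <= \esum_(x in [set: T]) (jeffreys (p x) (q x))%:E.
Proof.
move=> p0 q0 pq sp sq; set J := \esum_(x in _) _.
have J0 : 0 <= J by apply: esum_ge0 => x _; rewrite lee_fin jeffreys_ge0.
have [->|Jn] := eqVneq J +oo; first by rewrite leey.
have {}Jn : J < +oo by rewrite ltey.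
have qp x : (q x == 0%R) = (p x == 0%R) by rewrite pq.
set F := fun x => (p x * ln (p x / q x) + q x)%R.
set F' := fun x => (q x * ln (q x / p x) + p x)%R.
have Fp x : (p x <= F x)%R.
  by rewrite /F; have := xlnx_quot_ge (p0 x) (q0 x) (pq x); lra.
have F'q x : (q x <= F' x)%R.
  by rewrite /F'; have := xlnx_quot_ge (q0 x) (p0 x) (qp x); lra.
have FF' x : (F x + F' x = jeffreys (p x) (q x) + (p x + q x))%R.
  by rewrite jeffreysE// /F /F'; ring.
have F0 x : 0 <= (F x)%:E by rewrite lee_fin (le_trans (p0 x)).
have F'0 x : 0 <= (F' x)%:E by rewrite lee_fin (le_trans (q0 x)).
have pE0 x : 0 <= (p x)%:E by rewrite lee_fin.
have qE0 x : 0 <= (q x)%:E by rewrite lee_fin.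
have pqE0 x : 0 <= (p x)%:E + (q x)%:E by rewrite adde_ge0.
have j0 x : 0 <= (jeffreys (p x) (q x))%:E by rewrite lee_fin jeffreys_ge0.
have sumE : \esum_(x in [set: T]) (F x)%:E + \esum_(x in [set: T]) (F' x)%:E =
    J + (\esum_(x in [set: T]) (p x)%:E + \esum_(x in [set: T]) (q x)%:E).
  rewrite -esumD// -[X in _ = _ + X]esumD// -esumD//.
  by apply: eq_esum => x _; rewrite -!EFinD FF'.
have sS : J + (\esum_(x in [set: T]) (p x)%:E + \esum_(x in [set: T]) (q x)%:E) < +oo.
  by rewrite !lte_add_pinfty.
have sF : \esum_(x in [set: T]) (F x)%:E < +oo.
  by apply: le_lt_trans sS; rewrite -sumE leeDl// esum_ge0.
have sF' : \esum_(x in [set: T]) (F' x)%:E < +oo.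
  by apply: le_lt_trans sS; rewrite -sumE leeDr// esum_ge0.
have kE : kl_div p q = \esum_(x in [set: T]) (F x)%:E - \esum_(x in [set: T]) (q x)%:E.
  exact: kl_divE.
have kE' : kl_div q p = \esum_(x in [set: T]) (F' x)%:E - \esum_(x in [set: T]) (p x)%:E.
  exact: kl_divE.
rewrite /kl_sym kE kE' {kE kE' sS}.
move: sumE sF sF' sp sq Jn J0.
have : 0 <= \esum_(x in [set: T]) (F x)%:E by exact: esum_ge0.
have : 0 <= \esum_(x in [set: T]) (F' x)%:E by exact: esum_ge0.
have : 0 <= \esum_(x in [set: T]) (p x)%:E by apply: esum_ge0 => x _; rewrite lee_fin.
have : 0 <= \esum_(x in [set: T]) (q x)%:E by apply: esum_ge0 => x _; rewrite lee_fin.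
case: (esum _ _) => [sq| |]//; case: (esum _ _) => [sp| |]//.
case: (esum _ _) => [sF'| |]//; case: (esum _ _) => [sF| |]//; case: J => [j| |]//.
rewrite -!EFinD => _ _ _ _ [h] _ _ _ _ _ _; rewrite lee_fin; lra.
Qed.

Lemma esum_le_fset (T : choiceType) (f : T -> R) (B : \bar R) :
  (forall W : {fset T}, (\sum_(w <- W) f w)%:E <= B) ->
  \esum_(x in [set: T]) (f x)%:E <= B.
Proof.
move=> H; apply: ub_ereal_sup => _ [A [finA _] <-].
by rewrite fsbig_finite//= sumEFin.
Qed.

End KullbackLeibler.

(** * Traces and mixtures *)

Local Open Scope complex_scope.

Section Traces.
Local Open Scope sesquilinear_scope.
Variables (R : realType) (d : nat).
Implicit Types (A B rho : 'M[R[i]]_d).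

Lemma ip_delta (C : numClosedFieldType) (B : 'M[C]_d) k :
  ip (delta_mx k 0) (B *m delta_mx k 0) = B k k.
Proof.
rewrite -colE ipE (bigD1 k)//= big1 ?addr0; last first.
  by move=> i ik; rewrite !mxE (negPf ik) /= conjC0 mul0r.
by rewrite !mxE !eqxx /= conjC1 mul1r.
Qed.

(** In an eigenbasis of [A] the trace is a combination of diagonal entries of
    [rho] with the eigenvalues of [A] as weights. *)
Lemma psd_trace_ge0 rho A : psdmx rho -> psdmx A -> 0 <= rtrace (rho *m A).
Proof.
move=> /psdmx_ipP[_ rho0] /psdmx_specmx[P [a [Pu a0 ->]]].
apply: Re_ge0; rewrite /specmx !mulmxA mxtrace_mulC !mulmxA mxtrace_mulC.
rewrite /mxtrace sumr_ge0// => k _; rewrite mul_diag_mx !mxE mulr_ge0 ?ler0c//.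
have := rho0 (specvec P k).
by rewrite /specvec -{1}[P^t*]trmxCK mulmxA -ip_adj trmxCK !mulmxA ip_delta mxE.
Qed.

Lemma rtraceD A B : rtrace (A + B) = rtrace A + rtrace B.
Proof. by rewrite /rtrace linearD /=; case: (\tr A) => a b; case: (\tr B). Qed.

Lemma rtraceB A B : rtrace (A - B) = rtrace A - rtrace B.
Proof. by rewrite /rtrace linearB /=; case: (\tr A) => a b; case: (\tr B). Qed.

Lemma rtrace_sum (I : Type) (r : seq I) (F : I -> 'M[R[i]]_d) :
  rtrace (\sum_(k <- r) F k) = \sum_(k <- r) rtrace (F k).
Proof.
apply: (big_morph (@rtrace R d)) => [A B|]; first exact: rtraceD.
by rewrite /rtrace linear0.
Qed.

Lemma rtraceZ (c : R) A : rtrace (c%:C *: A) = c * rtrace A.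
Proof. by rewrite /rtrace mxtraceZ; case: (\tr A) => a b /=; rewrite mul0r subr0. Qed.

Lemma rtrace_decomposition rho A (l c : R) : density rho ->
  rtrace (rho *m (l%:C%:M + c%:C *: A)) = l + c * rtrace (rho *m A).
Proof.
move=> [_ tr1]; rewrite mulmxDr rtraceD -scalemxAr rtraceZ mul_mx_scalar rtraceZ.
by rewrite [rtrace rho]/rtrace tr1 mulr1.
Qed.

End Traces.

Section Mixtures.
Variables (R : realType) (D : nat).

(** Inserting the sign [b] at [j] enumerates the sign vectors whose [j]-th sign
    is [b]. *)
Lemma mixtureE (T : Type) (P : signs D -> T -> R) j b w :
  mixture P j b w = (2 ^+ D.-1)^-1 * \sum_(nu : signs D.-1) P (insert_sign j b nu) w.
Proof.
rewrite /mixture; congr (_ * _).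
pose del (nu : signs D) : signs D.-1 := [ffun k => nu (lift j k)].
rewrite (reindex_onto (insert_sign j b) del) /=.
  apply: eq_bigl => nu; rewrite ffunE unlift_none eqxx /=; apply/eqP.
  by apply/ffunP => k; rewrite !ffunE liftK.
move=> nu /eqP nub; apply/ffunP => k; rewrite !ffunE.
by case: unliftP => [k' ->|->]; rewrite ?ffunE.
Qed.

End Mixtures.

(** * Merging outcomes *)

Lemma ler_sum_uniq (R : numDomainType) (T : finType) (s : seq T) (h : T -> R) :
  uniq s -> (forall x, 0 <= h x) -> \sum_(x <- s) h x <= \sum_x h x.
Proof.
move=> us h0; rewrite big_uniq//= [leRHS](bigID (mem s))/= lerDl.
by rewrite sumr_ge0.
Qed.

(** A finite set [W] of product outcomes can be seen through a measurement with
    finitely many outcomes: in each factor, the outcomes whose code is at least a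
    bound exceeding all codes in [W] are merged into one. *)
Lemma finite_coarse_graining (R : realType) (d n : nat) (K : R)
  (Omega : 'I_n -> countType) (M : forall i : 'I_n, Omega i -> 'M[R[i]]_d)
  (W : {fset {dffun forall i, Omega i}}) :
  0 <= K -> (forall i, measurement (M i)) ->
  (forall i w, balanced K (effect (M i) w)) ->
  exists (J : finType) (G : 'I_n -> J -> 'M[R[i]]_d)
    (enc : {dffun forall i, Omega i} -> {ffun 'I_n -> J}),
  [/\ forall i x, balanced K (G i x), forall i, \sum_x G i x = 1%:M,
      {in W &, injective enc} &
      forall w i, w \in W -> G i (enc w i) = effect (M i) (w i)].
Proof.
move=> K0 mM bM.
pose N := (\max_(w <- W) \max_i choice.pickle (w i)).+1.
have ltN w i : w \in W -> (choice.pickle (w i) < N)%N.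
  move=> wW; rewrite ltnS.
  rewrite (leq_trans (leq_bigmax (F := fun i => choice.pickle (w i)) i))//.
  exact: (leq_bigmax_seq (F := fun w : {dffun _} => \max_i choice.pickle (w i))).
(* The index [N] stands for all outcomes whose code is at least [N]. *)
pose s i : seq (Omega i) := pmap pickle_inv (iota 0 N).
pose g i k : 'M[R[i]]_d := oapp (effect (M i)) 0 (pickle_inv k).
pose rest i : 'M[R[i]]_d := 1%:M - \sum_(w <- [fset x in s i]%fset) effect (M i) w.
pose G i (x : 'I_N.+1) := if (x < N)%N then g i x else rest i.
pose enc (w : {dffun forall i, Omega i}) : {ffun 'I_n -> 'I_N.+1} :=
  [ffun i => inord (choice.pickle (w i))].
have encE w i : w \in W -> enc w i = choice.pickle (w i) :> nat.
  by move=> wW; rewrite ffunE inordK// ltnS ltnW// ltN.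
exists 'I_N.+1, G, enc; split.
- move=> i x; rewrite /G; case: ifP => _; last exact: remainder_balanced.
  rewrite /g; case: pickle_inv => [w|] /=; first exact: bM.
  by have := @balanced_sum R d K _ [::] (effect (M i)) (bM i); rewrite big_nil.
- move=> i; rewrite big_ord_recr /= {2}/G ltnn.
  have -> : \sum_(k < N) G i (widen_ord (leqnSn N) k) = \sum_(w <- s i) effect (M i) w.
    rewrite /s big_pmap -[iota 0 N](_ : index_iota 0 N = _) ?big_mkord.
      by apply: eq_bigr => k _; rewrite /G /= ltn_ord.
    by rewrite /index_iota subn0.
  rewrite /rest [X in _ - X](perm_big (s i)) ?subrKC//=.
  apply: uniq_perm; rewrite ?fset_uniq//; last by move=> x; rewrite !inE.
  by rewrite (pmap_uniq pickle_invK)// iota_uniq.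
- move=> w w' wW w'W ee; apply/ffunP => i; apply: (pcan_inj pickleK_inv).
  by rewrite -encE// -encE// ee.
- by move=> w i wW; rewrite /G encE// ltN// /g pickleK_inv.
Qed.

(** * The bound for finitely many outcomes *)

Section FiniteOutcomes.
Variables (R : realType) (d D n : nat) (K : R).
Variables (rho : signs D -> 'M[R[i]]_d) (hrho : forall nu, density (rho nu)).
Hypotheses (K1 : 1 <= K) (d0 : (0 < d)%N).
Variables (J : finType) (G : 'I_n -> J -> 'M[R[i]]_d).
Hypotheses (bG : forall i x, balanced K (G i x)) (sG : forall i, \sum_x G i x = 1%:M).

Let p nu i x := rtrace (rho nu *m G i x).

Lemma outcome_sum1 nu i : \sum_x p nu i x = 1.
Proof.
rewrite -rtrace_sum -mulmx_sumr sG mulmx1 /rtrace.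
by have [_ ->] := hrho nu.
Qed.

Lemma outcome_ge0 nu i x : 0 <= p nu i x.
Proof. by apply: psd_trace_ge0; [case: (hrho nu) | case: (bG i x)]. Qed.

Lemma effect_coefficients : exists (l : 'I_n -> J -> R) (A : 'I_n -> J -> 'M[R[i]]_d),
  [/\ forall i x, 0 <= l i x, forall i x, psdmx (A i x) /\ opnorm (A i x) <= 1 &
   forall nu i x, p nu i x = l i x + (K - 1) * l i x * rtrace (rho nu *m A i x)].
Proof.
have /choice[f fP] : forall ix : 'I_n * J, exists lA : R * 'M[R[i]]_d,
    [/\ 0 <= lA.1, psdmx lA.2, opnorm lA.2 <= 1 &
    G ix.1 ix.2 = lA.1%:C%:M + ((K - 1) * lA.1)%:C *: lA.2].
  move=> [i x]; have [l [A h]] := balanced_decomposition K1 d0 (bG i x).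
  by exists (l, A).
exists (fun i x => (f (i, x)).1), (fun i x => (f (i, x)).2).
split=> [i x|i x|nu i x]; have [f0 f1 f2 f3] := fP (i, x) => //.
by rewrite /p [G i x]f3 rtrace_decomposition.
Qed.

(** For every state the probability vanishes exactly when the least eigenvalue
    [l] of the effect does. *)
Lemma outcome_eq0 nu nu' i x : (p nu i x == 0) = (p nu' i x == 0).
Proof.
have [l [A [l0 A01 pE]]] := effect_coefficients.
have key nu1 : (p nu1 i x == 0) = (l i x == 0).
  have a0 : 0 <= rtrace (rho nu1 *m A i x).
    by apply: psd_trace_ge0; [case: (hrho nu1) | case: (A01 i x)].
  rewrite pE -mulrA mulrCA -{1}[l i x]mulr1 -mulrDr mulf_eq0.
  by rewrite [X in _ || X]gt_eqF ?orbF// ltr_wpDr// mulr_ge0// subr_ge0.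
by rewrite !key.
Qed.

Let q nu (f : {ffun 'I_n -> J}) := \prod_i p nu i (f i).

Lemma product_outcome_sum1 nu : \sum_f q nu f = 1.
Proof.
by rewrite /q -bigA_distr_bigA big1// => i _; exact: outcome_sum1.
Qed.

Lemma product_outcome_eq0 nu nu' f : (q nu f == 0) = (q nu' f == 0).
Proof.
apply/idP/idP => /prodf_eq0[i _ h]; apply/prodf_eq0; exists i => //.
  by rewrite -(outcome_eq0 nu).
by rewrite -(outcome_eq0 nu').
Qed.

Let separation (A : 'M[R[i]]_d) : R := \sum_(j < D) (2 ^+ D.-1)^-1 *
  \sum_(nu : signs D.-1) rtrace (A *m (rho (insert_sign j true nu)
                             - rho (insert_sign j false nu))) ^+ 2.

(** Both probabilities are at least [l], and they differ by
    [(K - 1) * l * rtrace (A *m (rho nu - rho nu'))].  If [l = 0] both vanish. *)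
Lemma jeffreys_outcome_le i (l : R) A nu nu' x : 0 <= l -> psdmx A ->
  (forall nu, p nu i x = l + (K - 1) * l * rtrace (rho nu *m A)) ->
  jeffreys (p nu i x) (p nu' i x) <=
  (K - 1) ^+ 2 * l * rtrace (A *m (rho nu - rho nu')) ^+ 2.
Proof.
move=> l0 A0 pE.
have a0 nu1 : 0 <= rtrace (rho nu1 *m A).
  by apply: psd_trace_ge0; [case: (hrho nu1) | exact: A0].
have lp nu1 : l <= p nu1 i x.
  by rewrite pE lerDl; apply: mulr_ge0 => //; rewrite mulr_ge0// subr_ge0.
have [l00|ln] := eqVneq l 0.
  have p0 nu1 : p nu1 i x = 0 by rewrite pE l00 mulr0 mul0r addr0.
  by rewrite !p0 jeffreysxx// l00 mulr0 mul0r.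
have lpos : 0 < l by rewrite lt_def ln.
apply: le_trans (jeffreys_le_sqr lpos (lp nu) (lp nu')) _.
have -> : rtrace (A *m (rho nu - rho nu')) = rtrace (rho nu *m A) - rtrace (rho nu' *m A).
  by rewrite mulmxBr rtraceB /rtrace !(mxtrace_mulC A).
rewrite !pE; apply: eq_ler; field.
by rewrite ln.
Qed.

(** Summing [jeffreys_outcome_le] over signs first, each outcome [x] of each
    factor [i] is tested by its own [A i x], at most the supremum; the weights
    [l i x] then sum to at most [n]. *)
Lemma finite_information_bound :
  ((\sum_(j < D) \sum_f jeffreys (mixture q j true f) (mixture q j false f))%:E
   <= (n%:R * (K - 1) ^+ 2)%:E *
   ereal_sup [set (separation A)%:E | A in [set A | psdmx A /\ (opnorm A <= 1)%R]])%E.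
Proof.
have [l [A [l0 A01 pE]]] := effect_coefficients.
have q0 nu f : 0 <= q nu f by apply: prodr_ge0 => i _; exact: outcome_ge0.
have c0 : 0 < (2 ^+ D.-1)^-1 :> R by rewrite invr_gt0 exprn_gt0.
have separation_ge0 B : 0 <= separation B.
  apply: sumr_ge0 => j _; apply: mulr_ge0; first exact: ltW.
  by apply: sumr_ge0 => nu _; exact: sqr_ge0.
have suml (nu0 : signs D) i : \sum_x l i x <= 1.
  rewrite -(outcome_sum1 nu0 i); apply: ler_sum => x _; rewrite pE lerDl mulr_ge0//.
    by rewrite mulr_ge0// subr_ge0.
  by apply: psd_trace_ge0; [case: (hrho nu0) | case: (A01 i x)].
apply: le_trans (_ : (\sum_i \sum_x ((K - 1) ^+ 2 * l i x) * separation (A i x))%:E <= _)%E.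
  rewrite lee_fin.
  apply: le_trans (_ : \sum_(j < D) (2 ^+ D.-1)^-1 * \sum_(nu : signs D.-1)
     \sum_i \sum_x (K - 1) ^+ 2 * l i x * rtrace (A i x *m (rho (insert_sign j true nu)
                             - rho (insert_sign j false nu))) ^+ 2 <= _).
    apply: ler_sum => j _; under eq_bigr do rewrite !mixtureE jeffreysZ//.
    rewrite -mulr_sumr ler_wpM2l ?(ltW c0)//.
    apply: le_trans (_ : \sum_f \sum_(nu : signs D.-1)
        jeffreys (q (insert_sign j true nu) f) (q (insert_sign j false nu) f) <= _).
      apply: ler_sum => f _; apply: jeffreys_sum => // nu _.
      exact: product_outcome_eq0.
    rewrite exchange_big; apply: ler_sum => nu _ /=.
    rewrite jeffreys_product//;
      do ?[exact: outcome_ge0|exact: outcome_sum1|exact: outcome_eq0].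
    apply: ler_sum => i _; apply: ler_sum => x _.
    apply: jeffreys_outcome_le => //; last by case: (A01 i x).
  apply: eq_ler.
  rewrite /separation.
  under eq_bigr => j _ do rewrite exchange_big mulr_sumr.
  rewrite exchange_big; apply: eq_bigr => i _ /=.
  under eq_bigr => j _ do rewrite exchange_big mulr_sumr.
  rewrite exchange_big; apply: eq_bigr => x _ /=.
  by rewrite mulr_sumr; apply: eq_bigr => j _; rewrite -mulr_sumr mulrCA.
set S := ereal_sup _.
have separation_le i x : ((separation (A i x))%:E <= S)%E.
  by apply: ereal_sup_ubound; exists (A i x).
have S0 : (0 <= S)%E.
  apply: le_trans (_ : (separation (specmx 1%:M (\row_k (0 : R)%:C)))%:E <= _)%E.
    by rewrite lee_fin.
  apply: ereal_sup_ubound; exists (specmx 1%:M (\row_k (0 : R)%:C)) => //.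
  split; first exact: psdmx_of_specmx.
  apply: opnorm_specmx_le1 => [|k]; last by rewrite mxE lexx ler01.
  by apply/unitarymxP; rewrite trmx1 map_mx1 mulmx1.
have cl0 i x : 0 <= (K - 1) ^+ 2 * l i x by rewrite mulr_ge0// sqr_ge0.
apply: le_trans (_ : (\sum_i \sum_x (K - 1) ^+ 2 * l i x)%:E * S <= _)%E.
  rewrite -!sumEFin ge0_sume_distrl; last first.
    by move=> i _; rewrite lee_fin sumr_ge0.
  apply: lee_sum => i _; rewrite -!sumEFin ge0_sume_distrl; last first.
    by move=> x _; rewrite lee_fin.
  by apply: lee_sum => x _; rewrite EFinM lee_wpmul2l// lee_fin.
apply: lee_wpmul2r => //; rewrite lee_fin.
rewrite -[n in n%:R]card_ord -sumr_const mulr_suml; apply: ler_sum => i _.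
rewrite mul1r -mulr_sumr ler_piMr ?sqr_ge0//.
exact: (suml [ffun=> true]).
Qed.

End FiniteOutcomes.

(** * Countably many outcomes *)

Lemma kappa_sub1 (R : realType) (alpha : R) : 0 <= alpha < 2^-1 ->
  kappa alpha - 1 = 8 * alpha / (1 - 2 * alpha) ^+ 2.
Proof.
move=> /andP[a0 a2]; rewrite /kappa; field.
by rewrite gt_eqF//; lra.
Qed.

Theorem theorem11 (R : realType) (alpha : R) (d D n : nat)
    (halpha : 0 <= alpha < 2^-1)
    (hd : (1 <= d)%N) (hD : (1 <= D)%N) (hn : (1 <= n)%N)
    (rho : signs D -> 'M[R[i]]_d) (hrho : forall nu, density (rho nu))
    (Omega : 'I_n -> countType) (M : forall i : 'I_n, Omega i -> 'M[R[i]]_d)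
    (hM : locally_gentle alpha M) :
  (\sum_(j < D) kl_sym (mixture (fun nu => outcome_dist M (rho nu)) j true)
                       (mixture (fun nu => outcome_dist M (rho nu)) j false)
   <= (64 * n%:R * alpha ^+ 2 / (1 - 2 * alpha) ^+ 4)%:E *
      ereal_sup
        [set (\sum_(j < D) (2 ^+ D.-1)^-1 * \sum_(nu : signs D.-1)
               rtrace (A *m (rho (insert_sign j true nu)
                             - rho (insert_sign j false nu))) ^+ 2)%:E
        | A in [set A : 'M[R[i]]_d | psdmx A /\ (opnorm A <= 1)%R]])%E.
Proof.
have K1 := kappa_ge1 halpha; have K0 : 0 <= kappa alpha by exact: le_trans K1.
have -> : 64 * n%:R * alpha ^+ 2 / (1 - 2 * alpha) ^+ 4 =
    n%:R * (kappa alpha - 1) ^+ 2.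
  by rewrite kappa_sub1// exprMn exprVn -exprM exprMn -natrX; ring.
have mM i : measurement (M i) by case: (hM i).
have bM i w : balanced (kappa alpha) (effect (M i) w).
  by apply: gentle_effect_balanced; rewrite ?halpha//; case: (hM i).
pose P nu := outcome_dist M (rho nu).
have c0 : 0 < (2 ^+ D.-1)^-1 :> R by rewrite invr_gt0 exprn_gt0.
have transfer (W : {fset {dffun forall i, Omega i}}) : exists (J : finType)
    (G : 'I_n -> J -> 'M[R[i]]_d) (enc : {dffun forall i, Omega i} -> {ffun 'I_n -> J}),
  [/\ forall i x, balanced (kappa alpha) (G i x), forall i, \sum_x G i x = 1%:M,
    uniq [seq enc w | w <- W] &
    forall nu w, w \in W -> P nu w = \prod_i rtrace (rho nu *m G i (enc w i))].
  have [J [G [enc [bG sG ei eE]]]] := finite_coarse_graining W K0 mM bM.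
  exists J, G, enc; split=> //; first by rewrite map_inj_in_uniq ?fset_uniq.
  by move=> nu w wW; apply: eq_bigr => i _; rewrite eE.
have P0 nu w : 0 <= P nu w.
  apply: prodr_ge0 => i _; apply: psd_trace_ge0; first by case: (hrho nu).
  by case: (bM i (w i)).
have mix0 j b w : 0 <= mixture P j b w.
  by apply: mulr_ge0; [exact: ltW | exact: sumr_ge0].
have mix_eq0 j w : (mixture P j true w == 0) = (mixture P j false w == 0).
  have [J [G [enc [bG sG _ PE]]]] := transfer [fset w]%fset.
  have Pnn nu nu' : (P nu w == 0) = (P nu' w == 0).
    rewrite !PE ?inE//.
    exact: (product_outcome_eq0 hrho K1 hd bG).
  rewrite !mixtureE !mulf_eq0 (gt_eqF c0) /=.
  rewrite psumr_eq0; last by move=> nu _; exact: P0.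
  rewrite psumr_eq0; last by move=> nu _; exact: P0.
  by apply: eq_all => nu; exact: Pnn.
(* Finite total masses allow the two divergences to be added term by term. *)
have mass j b : (\esum_(w in [set: {dffun forall i, Omega i}]) (mixture P j b w)%:E < +oo)%E.
  apply: (@le_lt_trans _ _ ((2 ^+ D.-1)^-1 * \sum_(nu : signs D.-1) 1)%:E); last exact: ltry.
  apply: esum_le_fset => W; rewrite lee_fin.
  have [J [G [enc [bG sG uW PE]]]] := transfer W.
  under eq_bigr do rewrite mixtureE.
  rewrite -mulr_sumr ler_wpM2l ?(ltW c0)// exchange_big; apply: ler_sum => nu _ /=.
  rewrite big_seq; under eq_bigr => w wW do rewrite PE//.
  rewrite -big_seq -(big_map enc xpredT (fun f => \prod_i rtrace (rho _ *m G i (f i)))).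
  apply: le_trans (ler_sum_uniq uW _) _.
    by move=> f; apply: prodr_ge0 => i _; exact: (outcome_ge0 hrho bG).
  by rewrite (product_outcome_sum1 hrho sG).
apply: le_trans (_ : \sum_(j < D) \esum_(w in [set: {dffun forall i, Omega i}])
    (jeffreys (mixture P j true w) (mixture P j false w))%:E <= _)%E.
  by apply: lee_sum => j _; apply: kl_sym_le_jeffreys.
rewrite -esum_sum; last by move=> w j _ _; rewrite lee_fin jeffreys_ge0.
under eq_esum do rewrite sumEFin.
apply: esum_le_fset => W.
have [J [G [enc [bG sG uW PE]]]] := transfer W.
apply: le_trans (finite_information_bound hrho K1 hd bG sG); rewrite lee_fin.
rewrite exchange_big; apply: ler_sum => j _ /=.
pose Q nu (f : {ffun 'I_n -> J}) := \prod_i rtrace (rho nu *m G i (f i)).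
have Q0 nu f : 0 <= Q nu f by apply: prodr_ge0 => i _; exact: (outcome_ge0 hrho bG).
have mE b w : w \in W -> mixture P j b w = mixture Q j b (enc w).
  by move=> wW; rewrite /mixture; congr (_ * _); apply: eq_bigr => nu _; rewrite PE.
rewrite big_seq; under eq_bigr => w wW do rewrite !mE//.
rewrite -big_seq -(big_map enc xpredT
  (fun f => jeffreys (mixture Q j true f) (mixture Q j false f))).
apply: ler_sum_uniq => // f; apply: jeffreys_ge0;
  by apply: mulr_ge0; [exact: ltW | exact: sumr_ge0].
Qed.
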